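(* $\chi(G)\le \frac{3}{2}\left(\omega^2(G)-\omega(G)\right)$ if $G$ is (crown, $P_5$)-free.
   Context: All graphs are finite and simple. $\chi(G)$ is the chromatic number and $\omega(G)$ the clique number of $G$; $\omega^2(G)$ means $(\omega(G))^2$. $P_5$ is the path on $5$ vertices. The crown is the graph $K_1+K_{1,3}$, i.e. the graph on five vertices obtained from the claw $K_{1,3}$ by adding a new vertex adjacent to all four vertices of $K_{1,3}$. A graph is $F$-free if it has no induced subgraph isomorphic to $F$, and $(F_1,F_2)$-free if it is both $F_1$-free and $F_2$-free.
   Formalization: The formal theorem additionally assumes ω(G) ≠ 1: for nonempty edgeless graphs, which are (crown, P_5)-free, ω(G) = χ(G) = 1 and the stated bound would read 1 ≤ 0. *)

(* Defs.v *)
From mathcomp Require Import all_boot.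
Set Implicit Arguments.
Unset Strict Implicit.
Unset Printing Implicit Defensive.

Record sgraph := SGraph {
  svertex :> finType;
  sedge : rel svertex;
  sedge_sym : symmetric sedge;
  sedge_irr : irreflexive sedge }.

Section Invariants.
Variable G : sgraph.

Definition proper_coloring k (f : {ffun G -> 'I_k}) : bool :=
  [forall x, forall y, sedge x y ==> (f x != f y)].

Definition colorable k : bool :=
  [exists f : {ffun G -> 'I_k}, proper_coloring f].

Lemma ex_colorable : exists k, colorable k.
Proof.
exists #|G|; apply/existsP; exists [ffun x => enum_rank x].
apply/forallP=> x; apply/forallP=> y; apply/implyP=> xy; rewrite !ffunE.
by apply: contraTneq xy => /enum_rank_inj ->; rewrite sedge_irr.
Qed.

Definition chromatic_number : nat := ex_minn ex_colorable.

Definition clique (A : {set G}) : bool :=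
  [forall x in A, forall y in A, (x != y) ==> sedge x y].

Definition clique_number : nat := \max_(A : {set G} | clique A) #|A|.

End Invariants.

Section Induced.
Variables (G : sgraph) (S : {set G}).

Definition induced_edge : rel {x : G | x \in S} :=
  fun x y => sedge (val x) (val y).

Lemma induced_sym : symmetric induced_edge.
Proof. by move=> x y; apply: sedge_sym. Qed.

Lemma induced_irr : irreflexive induced_edge.
Proof. by move=> x; apply: sedge_irr. Qed.

Definition induced : sgraph := SGraph induced_sym induced_irr.

End Induced.

Definition isomorphic (G H : sgraph) : Prop :=
  exists2 f : G -> H, bijective f & forall x y, sedge (f x) (f y) = sedge x y.

Definition is_free (F G : sgraph) : Prop :=
  forall S : {set G}, ~ isomorphic (induced S) F.

Section Complete.
Variable n : nat.

Definition complete_edge : rel 'I_n := fun i j => i != j.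

Lemma complete_sym : symmetric complete_edge.
Proof. by move=> i j; rewrite /complete_edge eq_sym. Qed.

Lemma complete_irr : irreflexive complete_edge.
Proof. by move=> i; rewrite /complete_edge eqxx. Qed.

Definition complete : sgraph := SGraph complete_sym complete_irr.

End Complete.

Section CompleteBipartite.
Variables m n : nat.

Definition biclique_edge : rel ('I_m + 'I_n)%type := fun u v =>
  match u, v with
  | inl _, inr _ | inr _, inl _ => true
  | _, _ => false
  end.

Lemma biclique_sym : symmetric biclique_edge.
Proof. by move=> [i|i] [j|j]. Qed.

Lemma biclique_irr : irreflexive biclique_edge.
Proof. by move=> [i|i]. Qed.

Definition biclique : sgraph := SGraph biclique_sym biclique_irr.

End CompleteBipartite.

Section Path.
Variable n : nat.

Definition path_edge : rel 'I_n :=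
  fun i j => (i.+1 == j :> nat) || (j.+1 == i :> nat).

Lemma path_sym : symmetric path_edge.
Proof. by move=> i j; rewrite /path_edge orbC. Qed.

Lemma path_irr : irreflexive path_edge.
Proof. by move=> i; rewrite /path_edge orbb gtn_eqF. Qed.

(* [n] counts vertices, not edges. *)
Definition path_graph : sgraph := SGraph path_sym path_irr.

End Path.

Section Join.
Variables G H : sgraph.

Definition join_edge : rel (G + H)%type := fun u v =>
  match u, v with
  | inl x, inl y => sedge x y
  | inr x, inr y => sedge x y
  | _, _ => true
  end.

Lemma join_sym : symmetric join_edge.
Proof. by move=> [x|x] [y|y] //=; apply: sedge_sym. Qed.

Lemma join_irr : irreflexive join_edge.
Proof. by move=> [x|x] /=; apply: sedge_irr. Qed.

Definition join : sgraph := SGraph join_sym join_irr.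

End Join.

Definition crown : sgraph := join (complete 1) (biclique 1 3).

(* Main.v *)
Require Import Defs.
From HB Require Import structures.
From mathcomp Require Import all_boot all_order all_algebra.
Set Implicit Arguments.
Unset Strict Implicit.
Unset Printing Implicit Defensive.

(** Write w for the clique number.  Two independent facts multiply to give the
    bound 3 * 'C(w, 2).

    Locally: the neighbourhood of a vertex v of a crown-free graph is claw-free,
    and its cliques have at most w - 1 vertices since v extends them.  In a
    claw-free graph the neighbourhood of a vertex has no three independent
    vertices, so the Ramsey bound for triangles limits its size
    ([card_no_stable3]), and greedy colouring then shows that N(v) is
    'C(w, 2)-colourable ([claw_free_colorable]).

    Globally: if all neighbourhoods in a P5-free graph are c-colourable, then
    the graph is 3c-colourable ([P5_free_local_bound]).  This is the path
    argument of Gyarfas.  In a connected graph pick v1 and give N(v1) c colours.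
    Each component C1 of the non-neighbours of v1 is attached to some v2 in
    N(v1); give C1 :&: N(v2) another c colours.  Each component C2 of what
    remains of C1 is attached to some v3 in C1 :&: N(v2), and C2 must lie inside
    N(v3): otherwise an edge ab of C2 leaving N(v3) makes v1 v2 v3 a b an induced
    P5.  So the last c colours suffice for every C2, and also for v1. *)

(** * Embeddings of forbidden graphs *)

Lemma embedding_not_free (F G : sgraph) (g : F -> G) :
  injective g -> (forall x y, sedge (g x) (g y) = sedge x y) -> ~ is_free F G.
Proof.
move=> injg edg fr; apply: (fr [set y in codom g]).
have gS x : g x \in [set y in codom g] by rewrite inE codom_f.
have Sg (u : {y : G | y \in [set y in codom g]}) : val u \in codom g.
  by have := valP u; rewrite inE.
exists (fun u => iinv (Sg u)); last by move=> u v; rewrite -edg !f_iinv.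
exists (fun x => Sub (g x) (gS x)) => [u|x].
  by apply: val_inj; rewrite /= f_iinv.
by apply: injg; rewrite f_iinv.
Qed.

Lemma P5_not_free (G : sgraph) (a b c d e : G) :
  [&& sedge a b, sedge b c, sedge c d & sedge d e] ->
  ~~ [|| sedge a c, sedge a d, sedge a e, sedge b d, sedge b e | sedge c e] ->
  ~ is_free (path_graph 5) G.
Proof.
move=> /and4P[ab bc cd de].
rewrite !negb_or => /and5P[/negbTE ac /negbTE ad /negbTE ae /negbTE bd].
move=> /andP[/negbTE be /negbTE ce].
(* No two vertices of P5 have the same neighbours, so the vertices differ. *)
have neq (x y z : G) : sedge z x -> sedge z y = false -> x != y.
  by move=> zx zy; apply: contraTneq zx => ->; rewrite zy.
have un : uniq [:: a; b; c; d; e].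
  rewrite /= !inE !negb_or !andbT -!andbA; do 9?[apply/andP; split].
  - by rewrite eq_sym (neq _ _ a) ?sedge_irr.
  - by rewrite eq_sym (neq _ _ d) // sedge_sym.
  - by rewrite eq_sym (neq _ _ e) // sedge_sym.
  - by rewrite eq_sym (neq _ _ d) // sedge_sym.
  - by rewrite eq_sym (neq _ _ b) ?sedge_irr.
  - by rewrite (neq _ _ a).
  - by rewrite (neq _ _ a).
  - by rewrite eq_sym (neq _ _ c) ?sedge_irr.
  - by rewrite (neq _ _ b).
  - by rewrite eq_sym (neq _ _ d) ?sedge_irr.
apply: (@embedding_not_free (path_graph 5) G
  (fun i : 'I_5 => nth a [:: a; b; c; d; e] i)) => [i j /eqP|i j].
  by rewrite nth_uniq // => /eqP/val_inj.
case: i => [[|[|[|[|[|i]]]]] ?] //; case: j => [[|[|[|[|[|j]]]]] ?] //=;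
  rewrite /path_edge /= ?sedge_irr //; first [done | by rewrite sedge_sym].
Qed.

Lemma crown_not_free (G : sgraph) (v x a b c : G) :
  sedge v x -> all (sedge v) [:: a; b; c] -> all (sedge x) [:: a; b; c] ->
  uniq [:: a; b; c] -> ~~ [|| sedge a b, sedge a c | sedge b c] ->
  ~ is_free crown G.
Proof.
move=> vx vs xs un; rewrite !negb_or => /and3P[/negbTE ab /negbTE ac /negbTE bc].
have vi (i : 'I_3) : sedge v (nth a [:: a; b; c] i).
  by apply: (allP vs); rewrite mem_nth.
have xi (i : 'I_3) : sedge x (nth a [:: a; b; c] i).
  by apply: (allP xs); rewrite mem_nth.
have neq (u w : G) : sedge u w -> u <> w by move=> uw E; rewrite E sedge_irr in uw.
apply: (@embedding_not_free crown G (fun u => match u with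
  | inl _ => v
  | inr (inl _) => x
  | inr (inr i) => nth a [:: a; b; c] i
  end)).
- move=> [i|[i|i]] [j|[j|j]].
  + by rewrite !ord1.
  + by move=> /(neq _ _ vx).
  + by move=> /(neq _ _ (vi j)).
  + by move=> /esym/(neq _ _ vx).
  + by rewrite !ord1.
  + by move=> /(neq _ _ (xi j)).
  + by move=> /esym/(neq _ _ (vi i)).
  + by move=> /esym/(neq _ _ (xi i)).
  + by move=> /eqP; rewrite nth_uniq // => /eqP/val_inj ->.
- move=> [i|[i|i]] [j|[j|j]] //.
  + by rewrite !ord1 /= /complete_edge eqxx sedge_irr.
  + exact: vi.
  + by rewrite sedge_sym.
  + by rewrite sedge_irr.
  + exact: xi.
  + by rewrite sedge_sym; exact: vi.
  + by rewrite sedge_sym; exact: xi.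
  + case: i => [[|[|[|i]]] ?] //; case: j => [[|[|[|j]]] ?] //=;
      rewrite ?sedge_irr //; first [done | by rewrite sedge_sym].
Qed.

Section Graph.
Variable G : sgraph.
Implicit Types (A B C S : {set G}) (x y z v : G) (k l w : nat).

(** * Colouring vertex sets *)

(** Colourings take values in nat, so that colourings of different sets can be
    shifted and glued without changing types. *)
Definition colorable_on A k : Prop :=
  exists f : G -> nat, {in A, forall x, f x < k} /\
    {in A &, forall x y, sedge x y -> f x != f y}.

Definition nbhd v : {set G} := [set x | sedge v x].

Definition joined A B : bool := [exists x in A, exists y in B, sedge x y].

Definition connected A : bool :=
  [forall S : {set G}, (S \proper A) && (S != set0) ==> joined S (A :\: S)].

Lemma joinedP A B :
  reflect (exists x y, [/\ x \in A, y \in B & sedge x y]) (joined A B).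
Proof.
apply: (iffP existsP) => [[x /andP[xA /existsP[y /andP[yB xy]]]]|[x [y [xA yB xy]]]].
  by exists x, y.
by exists x; rewrite xA; apply/existsP; exists y; rewrite yB.
Qed.

Lemma connected_cut A S :
  connected A -> S \subset A -> S != set0 -> A :\: S != set0 ->
  exists x y, [/\ x \in S, y \in A :\: S & sedge x y].
Proof.
move=> /forallP/(_ S)/implyP cA SA S0 AS0; apply/joinedP/cA.
by rewrite S0 properE SA -setD_eq0 AS0.
Qed.

Lemma colorable_on0 k : colorable_on set0 k.
Proof. by exists (fun=> 0); split=> [x|x y]; rewrite inE. Qed.

Lemma colorable_onS A B k : A \subset B -> colorable_on B k -> colorable_on A k.
Proof.
move=> /subsetP AB [f [fk pf]]; exists f; split=> [x /AB /fk //|x y /AB xB /AB yB].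
exact: pf.
Qed.

Lemma colorable_on_leq A k l : k <= l -> colorable_on A k -> colorable_on A l.
Proof.
by move=> kl [f [fk pf]]; exists f; split=> // x /fk /leq_trans; apply.
Qed.

Lemma colorable_onU A B k l :
  colorable_on A k -> colorable_on B l -> colorable_on (A :|: B) (k + l).
Proof.
move=> [f [fk pf]] [g [gl pg]].
exists (fun x => if x \in A then f x else k + g x); split=> [x|x y].
  rewrite inE; case: ifP => [/fk fx _|_ /= /gl gx]; last by rewrite ltn_add2l.
  by rewrite (leq_trans fx) ?leq_addr.
rewrite !inE; case: ifP => [xA _|_ /= xB]; case: ifP => [yA _|_ /= yB] xy.
- exact: pf.
- by rewrite neq_ltn (leq_trans (fk _ xA)) ?leq_addr.
- by rewrite neq_ltn orbC (leq_trans (fk _ yA)) ?leq_addr.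
- by rewrite eqn_add2l pg.
Qed.

Lemma colorable_on_glue A B k :
  ~~ joined A B -> colorable_on A k -> colorable_on B k ->
  colorable_on (A :|: B) k.
Proof.
move=> /joinedP nAB [f [fk pf]] [g [gk pg]].
exists (fun x => if x \in A then f x else g x); split=> [x|x y].
  by rewrite inE; case: ifP => [/fk|_ /= /gk].
rewrite !inE; case: ifP => [xA _|_ /= xB]; case: ifP => [yA _|_ /= yB] xy.
- exact: pf.
- by case: nAB; exists x, y.
- by case: nAB; exists y, x; rewrite sedge_sym.
- exact: pg.
Qed.

Lemma colorable_on_chromatic k : colorable_on setT k -> chromatic_number G <= k.
Proof.
move=> [f [fk pf]]; rewrite /chromatic_number; case: ex_minnP => m _; apply.
apply/existsP; exists [ffun x => Ordinal (fk x (in_setT x))].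
apply/forallP=> x; apply/forallP=> y; apply/implyP=> xy; rewrite !ffunE.
by rewrite -(inj_eq val_inj) /= pf ?inE.
Qed.

(** The sets B below are the connected components of A; they arise by cutting A
    along empty cuts until only connected pieces are left. *)
Lemma colorable_on_components A k :
  (forall B, B \subset A -> B != set0 -> connected B -> ~~ joined B (A :\: B) ->
     colorable_on B k) ->
  colorable_on A k.
Proof.
move: {2}#|A|.+1 (ltnSn #|A|) => n.
elim: n A => // n IHn A An compA.
have [->|A0] := eqVneq A set0; first exact: colorable_on0.
have [cA|] := boolP (connected A).
  apply: compA => //; rewrite setDv; apply/joinedP=> -[x [y [_]]].
  by rewrite inE.
rewrite negb_forall => /existsP[S]; rewrite negb_imply -andbA.
move=> /and3P[prSA S0 nS]; have SA := proper_sub prSA.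
(* A component of a side of an empty cut is a component of the whole. *)
have side (T : {set G}) : T \proper A -> ~~ joined T (A :\: T) -> colorable_on T k.
  move=> prT /joinedP nT; have TA := proper_sub prT; apply: IHn => [|B BT B0 cB /joinedP nB].
    by rewrite -ltnS (leq_trans _ An) // ltnS proper_card.
  apply: compA => //; first exact: subset_trans TA.
  apply/joinedP=> -[x [y [xB]]]; rewrite inE => /andP[ynB yA] xy.
  have [yT|ynT] := boolP (y \in T).
    by apply: nB; exists x, y; rewrite inE ynB.
  by apply: nT; exists x, y; rewrite inE ynT (subsetP BT).
rewrite -(setID A S) (setIidPr SA); apply: colorable_on_glue => //; first exact: side.
apply: side; first by rewrite properE subsetDl subsetD subxx /= -setI_eq0 (setIidPr SA).
have -> : A :\: (A :\: S) = S by rewrite setDDr setDv set0U (setIidPr SA).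
by apply/joinedP=> -[x [y [xA yS xy]]]; case/joinedP: nS; exists y, x; rewrite sedge_sym.
Qed.

(** * The local bound *)

Definition no_stable3 A : Prop :=
  {in A & &, forall x y z, uniq [:: x; y; z] ->
     [|| sedge x y, sedge x z | sedge y z]}.

Definition cliques_leq A w : Prop :=
  forall B, B \subset A -> clique B -> #|B| <= w.

Lemma clique1 x : clique [set x].
Proof.
by apply/forall_inP=> y /set1P ->; apply/forall_inP=> z /set1P ->; rewrite eqxx.
Qed.

Lemma clique_setU1 v B : B \subset nbhd v -> clique B -> clique (v |: B).
Proof.
move=> /subsetP Bv /forall_inP cB; apply/forall_inP=> x xvB; apply/forall_inP=> y.
move: xvB; rewrite !inE => /predU1P[->|xB] /predU1P[->|yB]; apply/implyP.
- by rewrite eqxx.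
- by move: (Bv _ yB); rewrite inE.
- by move: (Bv _ xB); rewrite inE sedge_sym.
- exact/implyP/(forall_inP (cB x xB)).
Qed.

Lemma cliques_leq_nbhd A x w :
  x \in A -> cliques_leq A w.+1 -> cliques_leq (A :&: nbhd x) w.
Proof.
move=> xA cA B; rewrite subsetI => /andP[BA Bx] cB.
have: #|x |: B| <= w.+1.
  by apply: cA (clique_setU1 Bx cB); rewrite subUset sub1set xA.
rewrite cardsU1; suff -> : x \notin B by [].
by apply/negP=> /(subsetP Bx); rewrite inE sedge_irr.
Qed.

(** This is R(3, w + 1) <= 'C(w + 2, 2): the non-neighbours of a vertex x form a
    clique, so they account for at most w vertices, and the cliques of the
    neighbourhood are smaller by one. *)
Lemma card_no_stable3 A w : no_stable3 A -> cliques_leq A w -> #|A| < 'C(w.+2, 2).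
Proof.
elim: w A => [|w IHw] A sA cA; have [->|[x xA]] := set_0Vmem A.
- by rewrite cards0.
- by have := cA [set x]; rewrite sub1set xA cards1 => /(_ isT (clique1 x)).
- by rewrite cards0 bin_gt0.
have nA : #|A :&: nbhd x| < 'C(w.+2, 2).
  apply: IHw (cliques_leq_nbhd xA cA).
  by move=> a b c /setIP[aA _] /setIP[bA _] /setIP[cA' _]; apply: sA.
have mA : #|A :\: nbhd x :\ x| <= w.+1.
  apply: cA; first by rewrite subDset subsetU // subsetDl orbT.
  apply/forall_inP=> a; rewrite !inE => /and3P[ax nxa aA].
  apply/forall_inP=> b; rewrite !inE => /and3P[bx nxb bA].
  apply/implyP=> ab; have := sA x a b xA aA bA.
  rewrite (negbTE nxa) (negbTE nxb) /= !inE negb_or ![x == _]eq_sym ax bx ab.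
  exact.
rewrite -(cardsID (nbhd x) A) (cardsD1 x (A :\: _)) !inE sedge_irr xA /=.
by rewrite binS bin1 -addSn leq_add.
Qed.

(** The hypothesis passes to subsets of A, so any vertex can be coloured last. *)
Lemma greedy_colorable A k :
  {in A, forall x, #|A :&: nbhd x| < k} -> colorable_on A k.
Proof.
move: {2}#|A|.+1 (ltnSn #|A|) => n.
elim: n A => // n IHn A An degA.
have [->|[x xA]] := set_0Vmem A; first exact: colorable_on0.
have [|y|f [fk pf]] := IHn (A :\ x).
- by rewrite -ltnS (leq_trans _ An) // (cardsD1 x A) xA.
- move=> /setD1P[_ yA]; apply: leq_ltn_trans (degA y yA).
  by rewrite subset_leq_card // setSI // subD1set.
(* Some colour misses the neighbours of x, as there are fewer than k of them. *)
have [i ik fi] : exists2 i : nat, i < k & {in A :&: nbhd x, forall y, f y != i}.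
  have : ~~ all [in map f (enum (A :&: nbhd x))] (iota 0 k).
    apply/negP=> /allP/(uniq_leq_size (iota_uniq 0 k)).
    by rewrite size_iota size_map -cardE leqNgt degA.
  case/allPn=> i; rewrite mem_iota => ik ni; exists i => // y yN.
  by apply: contraNneq ni => <-; apply: map_f; rewrite mem_enum.
exists (fun y => if y == x then i else f y); split=> [y yA|y z yA zA].
  by case: eqP => // /eqP yx; apply: fk; rewrite !inE yx.
case: (y =P x) => [->|/eqP yx]; case: (z =P x) => [->|/eqP zx] yz.
- by rewrite sedge_irr in yz.
- by rewrite eq_sym fi // !inE zA.
- by rewrite fi // !inE yA sedge_sym.
- by apply: pf => //; rewrite !inE ?yx ?zx.
Qed.

(** Within A, a vertex has fewer than R(3, w) neighbours: three independent ones
    would give a claw, and a clique of w of them would extend to one of size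
    w + 1. *)
Lemma claw_free_colorable A w :
  {in A, forall x, no_stable3 (A :&: nbhd x)} -> cliques_leq A w ->
  colorable_on A 'C(w.+1, 2).
Proof.
move=> clawA cA; apply: greedy_colorable => x xA.
case: w cA => [|w] cA; last by apply: card_no_stable3 (clawA x xA) (cliques_leq_nbhd xA cA).
by have := cA [set x]; rewrite sub1set xA cards1 => /(_ isT (clique1 x)).
Qed.

Lemma clique_leq_clique_number B : clique B -> #|B| <= clique_number G.
Proof. by move=> cB; apply: (@leq_bigmax_cond _ _ (fun A : {set G} => #|A|)). Qed.

Lemma crown_free_nbhd_colorable v :
  is_free crown G -> colorable_on (nbhd v) 'C(clique_number G, 2).
Proof.
move=> crG; have cN B : B \subset nbhd v -> clique B -> #|B| < clique_number G.
  move=> Bv cB; have := clique_leq_clique_number (clique_setU1 Bv cB).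
  rewrite cardsU1; suff -> : v \notin B by [].
  by apply/negP=> /(subsetP Bv); rewrite inE sedge_irr.
have w0 : 0 < clique_number G.
  apply: leq_ltn_trans (cN set0 _ _); rewrite ?cards0 ?sub0set //.
  by apply/forall_inP=> x; rewrite inE.
rewrite -(prednK w0); apply: claw_free_colorable => [x|B Bv cB]; last first.
  by rewrite -ltnS prednK // cN.
rewrite inE => vx a b c; rewrite !inE => /andP[va xa] /andP[vb xb] /andP[vc xc] un.
apply/negPn/negP=> st; apply: (@crown_not_free G v x a b c) crG => //=.
  by rewrite va vb vc.
by rewrite xa xb xc.
Qed.

(** * From local to global *)

(** One more vertex on the forbidden path would cost one more summand c; the path
    v1 v2 v3 a b of the proof stops the recursion at depth three.  Positivity of
    c pays for v1 itself, as isolated vertices have 0-colourable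
    neighbourhoods. *)
Lemma P5_free_local_bound c :
  0 < c -> is_free (path_graph 5) G -> (forall v, colorable_on (nbhd v) c) ->
  colorable_on setT (3 * c).
Proof.
move=> c0 p5 Nc; apply: colorable_on_components => H _ H0 cH _.
have [v1 v1H] := set0Pn _ H0.
pose M := H :\: nbhd v1 :\ v1.
have defH : H \subset nbhd v1 :|: ([set v1] :|: M).
  by apply/subsetP=> x xH; rewrite !inE xH; case: (sedge v1 x); case: (x == v1).
apply: colorable_onS defH _; rewrite mulSn; apply: colorable_onU => //.
apply: colorable_on_glue.
- by apply/joinedP=> -[x [y [/set1P -> ]]]; rewrite !inE => /and3P[_ /negbTE ->].
- exists (fun=> 0); split=> [x _|x y /set1P -> /set1P ->]; first by rewrite muln_gt0.
  by rewrite sedge_irr.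
apply: colorable_on_components => C1 C1M C10 cC1 nC1.
have C1H : C1 \subset H.
  by apply: subset_trans C1M _; rewrite /M setDDl subsetDl.
have C1v1 x : x \in C1 -> (x != v1) && ~~ sedge v1 x.
  by move=> /(subsetP C1M); rewrite !inE => /and3P[-> ->].
(* H is connected and C1 is a component of M, so v2 is found outside M. *)
have [u [v2 [uC1 v2H uv2]]] : exists x y, [/\ x \in C1, y \in H :\: C1 & sedge x y].
  apply: connected_cut => //; apply/set0Pn; exists v1; rewrite inE v1H andbT.
  by apply/negP=> /C1v1; rewrite eqxx.
move: v2H; rewrite inE => /andP[v2C1 v2H].
have v12 : sedge v1 v2.
  apply/negPn/negP=> n12; case/joinedP: nC1; exists u, v2; split=> //.
  rewrite !inE v2C1 v2H n12 !andbT /=; apply: contraTneq uv2 => ->.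
  by rewrite sedge_sym; case/andP: (C1v1 u uC1).
rewrite mul2n -addnn -(setID C1 (nbhd v2)); apply: colorable_onU.
  exact: colorable_onS (subsetIr _ _) (Nc v2).
apply: colorable_on_components => C2 C2C1 C20 cC2 nC2.
have C2v2 x : x \in C2 -> (x \in C1) && ~~ sedge v2 x.
  by move=> /(subsetP C2C1); rewrite !inE andbC.
(* Likewise C1 is connected and C2 is a component of C1 :\: nbhd v2. *)
have [t [v3 [tC2 v3C1 tv3]]] : exists x y, [/\ x \in C2, y \in C1 :\: C2 & sedge x y].
  apply: connected_cut => //; first exact: subset_trans C2C1 (subsetDl _ _).
  apply/set0Pn; exists u; rewrite inE uC1 andbT.
  by apply/negP=> /C2v2; rewrite sedge_sym uv2 andbF.
move: v3C1; rewrite inE => /andP[v3C2 v3C1].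
have v23 : sedge v2 v3.
  apply/negPn/negP=> n23; case/joinedP: nC2; exists t, v3; split=> //.
  by rewrite !inE v3C2 v3C1 n23.
(* It remains to see that C2 does not leave nbhd v3. *)
apply: colorable_onS (Nc v3); apply/setIidPl/eqP; apply/negPn/negP=> C2N.
have [a [b [aC2 bC2 ab]]] :
    exists x y, [/\ x \in C2 :&: nbhd v3, y \in C2 :\: (C2 :&: nbhd v3) & sedge x y].
  apply: connected_cut => //; first exact: subsetIl.
    by apply/set0Pn; exists t; rewrite !inE tC2 sedge_sym.
  by rewrite setDIr setDv set0U setD_eq0; apply: contraNN C2N => /setIidPl/eqP.
move: aC2 bC2; rewrite !inE negb_and => /andP[aC2 v3a] /andP[/orP[/negP//|v3b] bC2].
have /andP[aC1 v2a] := C2v2 a aC2; have /andP[bC1 v2b] := C2v2 b bC2.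
have /andP[_ v1a] := C1v1 a aC1; have /andP[_ v1b] := C1v1 b bC1.
have /andP[_ v13] := C1v1 v3 v3C1.
apply: (@P5_not_free G v1 v2 v3 a b) p5.
- by rewrite v12 v23 v3a ab.
- by rewrite !negb_or v13 v1a v1b v2a v2b v3b.
Qed.

End Graph.

Import Order.TTheory GRing.Theory Num.Theory.
Local Open Scope ring_scope.

(* If omega(G) = 1, then chi(G) = 1 but the bound is 0: the case omega(G) = 1
   (nonempty edgeless graphs) has to be excluded. *)
Theorem corollary1p1 (G : sgraph)
    (hG : clique_number G <> 1%N)
    (hcrown : is_free crown G)
    (hP5 : is_free (path_graph 5) G) :
  (chromatic_number G)%:R <=
    3%:R / 2%:R * ((clique_number G)%:R ^+ 2 - (clique_number G)%:R) :> rat.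
Proof.
have [w0|w0] := posnP (clique_number G).
  (* The cliques include all singletons, so G has no vertex. *)
  suff /colorable_on_chromatic : colorable_on [set: G] 0.
    by rewrite leqn0 => /eqP ->; rewrite w0 expr0n subrr mulr0.
  have noG (x : G) : False.
    by have := clique_leq_clique_number (clique1 x); rewrite cards1 w0.
  by exists (fun=> 0%N); split=> x; case: (noG x).
(* This is where w <> 1 enters: 'C(1, 2) = 0. *)
have c0 : (0 < 'C(clique_number G, 2))%N.
  by rewrite bin_gt0 ltn_neqAle eq_sym w0 andbT; apply/eqP.
have /colorable_on_chromatic chi :=
  P5_free_local_bound c0 hP5 (fun v => crown_free_nbhd_colorable v hcrown).
have E : 3%:R / 2%:R * ((clique_number G)%:R ^+ 2 - (clique_number G)%:R)
    = (3 * 'C(clique_number G, 2))%:R :> rat.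
  have b : ('C(clique_number G, 2) * 2 = clique_number G * (clique_number G).-1)%N.
    by rewrite bin_ffact ffactnS ffactn1.
  have b' := congr1 (fun n => n%:R : rat) b.
  rewrite !natrM -subn1 natrB // in b'.
  have -> : (clique_number G)%:R ^+ 2 - (clique_number G)%:R
     = 'C(clique_number G, 2)%:R * 2%:R :> rat by rewrite b' mulrBr mulr1 expr2.
  by rewrite natrM [_ * 2%:R]mulrC mulrA mulfVK.
by rewrite E ler_nat.
Qed.
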